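(* Let $U_i^m=u(x_i,t_m)$, where $u$ is the solution of the time-space fractional diffusion problem in the context, and let $\{u_i^m\mid 0\le i\le N,\ 0\le m\le M\}$ be the solution of the direct implicit difference scheme (DIDS) in the context. Put $e_i^m=U_i^m-u_i^m$, and let $p\in(0,2]$ (determined by the spatial regularity of $u$) be the order in the local truncation error bound stated in the context. Then $$\|\boldsymbol e^m\|_\infty=\mathcal O\big(M^{-\min\{r\gamma,\,2-\gamma\}}+h^p\big),\qquad 1\le m\le M,$$ i.e. there is a constant $C>0$ independent of $m,M,N$ such that $\|\boldsymbol e^m\|_\infty\le C(M^{-\min\{r\gamma,2-\gamma\}}+h^p)$ for all $1\le m\le M$.
   Context: Problem. Let $0<\gamma<1$, $\alpha\in(0,2)$, $T>0$, $l>0$, $\Omega=(-l,l)$, $\Omega^c=\mathbb R\setminus\Omega$, $\kappa(x,t)>0$. The function $u$ solves $${}^C_0D^\gamma_tu=-\kappa(x,t)(-\Delta)^{\alpha/2}u+f(x,t)\ \ (x\in\Omega,\,t\in(0,T]),\quad u=0\ \ (x\in\Omega^c,\ t\in[0,T]),\quad u(x,0)=\phi(x)\ \ (x\in\Omega),$$ where ${}^C_0D^\gamma_tu(x,t)=\frac1{\Gamma(1-\gamma)}\int_0^t(t-s)^{-\gamma}\partial_su(x,s)\,ds$ and $(-\Delta)^{\alpha/2}u(x)=c_{1,\alpha}\,\mathrm{P.V.}\int_{\mathbb R}\frac{u(x)-u(x')}{|x-x'|^{1+\alpha}}dx'$ with $c_{1,\alpha}=\frac{2^{\alpha-1}\alpha\Gamma(\frac{\alpha+1}{2})}{\sqrt\pi\,\Gamma(1-\alpha/2)}$.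 It is assumed that $|\partial_t^ku(x,t)|\le c_0t^{\gamma-k}$ for $0\le k\le3$, with a constant $c_0>0$. Mesh. $M,N,r$ are positive integers ($r$ fixed), $h=2l/N$, $x_i=-l+ih$ ($0\le i\le N$), $t_m=(m/M)^rT$ ($0\le m\le M$), $\tau_m=t_m-t_{m-1}$, $\kappa_i^m=\kappa(x_i,t_m)$, $f_i^m=f(x_i,t_m)$. Temporal discretization. $a^{(m,\gamma)}_k=\frac1{\tau_k}\int_{t_{k-1}}^{t_k}\frac{ds}{(t_m-s)^\gamma}$ for $1\le k\le m$, and $$D^\gamma_tv^m=\frac1{\Gamma(1-\gamma)}\Big[a^{(m,\gamma)}_mv^m-\sum_{k=1}^{m-1}\big(a^{(m,\gamma)}_{k+1}-a^{(m,\gamma)}_k\big)v^k-a^{(m,\gamma)}_1v^0\Big].$$ Spatial discretization. Let $\mu\in(\alpha,2]$, $\nu=\mu-\alpha$, $\kappa_\mu=1$ if $\mu\in(\alpha,2)$ and $\kappa_\mu=2$ if $\mu=2$, $C^h_{\alpha,\mu}=\frac{c_{1,\alpha}}{\nu h^\alpha}$. For a grid function $v$ with $v_0=v_N=0$ put $(-\Delta)^{\alpha/2}_{h,\mu}v_i=\sum_{j=1}^{N-1}a_{ij}v_j$ ($1\le i\le N-1$), where $$a_{ij}=C^h_{\alpha,\mu}\begin{cases}\sum\limits_{\ell=2}^{N-1}\frac{(\ell+1)^\nu-(\ell-1)^\nu}{\ell^\mu}+\frac{N^\nu-(N-1)^\nu}{N^\mu}+(2^\nu+\kappa_\mu-1)+\frac{2\nu}{\alpha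 N^\alpha},& j=i,\\[2mm] -\frac{2^\nu+\kappa_\mu-1}{2},& j=i\pm1,\\[1mm] -\frac{(|j-i|+1)^\nu-(|j-i|-1)^\nu}{2|j-i|^\mu},& j\neq i,\,i\pm1.\end{cases}$$ DIDS: $D^\gamma_tu_i^m=-\kappa_i^m(-\Delta)^{\alpha/2}_{h,\mu}u_i^m+f_i^m$ for $1\le i\le N-1$, $1\le m\le M$, with $u_0^m=u_N^m=0$ ($0\le m\le M$) and $u_i^0=\phi(x_i)$ ($1\le i\le N-1$). Local truncation error. Define $R_i^m$ by $D^\gamma_tU_i^m=-\kappa_i^m(-\Delta)^{\alpha/2}_{h,\mu}U_i^m+f_i^m+R_i^m$. The order $p\in(0,2]$ is such that, for a constant $c_2>0$ depending on the problem but not on $M,N$, $$|R_i^m|\le c_2\big(m^{-\min\{r(1+\gamma),\,2-\gamma\}}+h^p\big),\qquad 1\le i\le N-1,\ 1\le m\le M.$$ Norm: $\|\boldsymbol v\|_\infty=\max_{0\le i\le N}|v_i|$. *)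

(* Defs.v *)
From HB Require Import structures.
From mathcomp Require Import all_boot all_order all_algebra.
From mathcomp Require Import all_classical all_reals all_analysis.
Import Order.TTheory GRing.Theory Num.Theory.
Import numFieldNormedType.Exports.

Set Implicit Arguments.
Unset Strict Implicit.
Unset Printing Implicit Defensive.

Local Open Scope classical_set_scope.
Local Open Scope ring_scope.

(* Functions of (x, t) are total maps R -> R -> R (space first, time second);
   only their values for t in [0, T] are ever used. *)

Definition Gamma (R : realType) (z : R) : R :=
  \int[@lebesgue_measure R]_(s in `]0, +oo[) (s `^ (z - 1) * expR (- s)).

(* Difference quotients use only times in [0, T], so that the derivative is
   two-sided on ]0, T[ and one-sided at the final time T. *)
Definition tquotient (R : realType) (g : R -> R) (t : R) : R -> R :=
  fun s => (g s - g t) / (s - t).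

Definition tderivable (R : realType) (T : R) (g : R -> R) (t : R) : Prop :=
  cvg (tquotient g t @ within `[0, T] t^').

Definition tderive (R : realType) (T : R) (g : R -> R) (t : R) : R :=
  lim (tquotient g t @ within `[0, T] t^').

Definition tderiven (R : realType) (T : R) (k : nat) (g : R -> R) : R -> R :=
  iter k (tderive T) g.

Definition caputo_integrand (R : realType) (T gamma : R) (g : R -> R) (t : R) :
    R -> R :=
  fun s => (t - s) `^ (- gamma) * tderive T g s.

Definition caputo_exists (R : realType) (T gamma : R) (g : R -> R) (t : R) :
    Prop :=
  (forall s, 0 < s < t -> tderivable T g s) /\
  (@lebesgue_measure R).-integrable `]0, t[
    (EFin \o caputo_integrand T gamma g t).

Definition caputo (R : realType) (T gamma : R) (g : R -> R) (t : R) : R :=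
  (Gamma (1 - gamma))^-1 *
  \int[@lebesgue_measure R]_(s in `]0, t[) caputo_integrand T gamma g t s.

Definition fraclap_const (R : realType) (alpha : R) : R :=
  2 `^ (alpha - 1) * alpha * Gamma ((alpha + 1) / 2) /
  (Num.sqrt pi * Gamma (1 - alpha / 2)).

Definition fraclap_integrand (R : realType) (alpha : R) (v : R -> R) (x : R) :
    R -> R :=
  fun y => (v x - v y) / `|x - y| `^ (1 + alpha).

Definition fraclap_trunc (R : realType) (alpha : R) (v : R -> R) (x eps : R) :
    R :=
  \int[@lebesgue_measure R]_(y in [set y | eps < `|x - y|])
    fraclap_integrand alpha v x y.

Definition fraclap_exists (R : realType) (alpha : R) (v : R -> R) (x : R) :
    Prop :=
  (forall eps, 0 < eps ->
     (@lebesgue_measure R).-integrable [set y | eps < `|x - y|]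
       (EFin \o fraclap_integrand alpha v x)) /\
  cvg (fraclap_trunc alpha v x @ 0^'+).

Definition fraclap (R : realType) (alpha : R) (v : R -> R) (x : R) : R :=
  fraclap_const alpha * lim (fraclap_trunc alpha v x @ 0^'+).

Definition diffusion_solution (R : realType) (gamma alpha T l : R)
    (kappa f : R -> R -> R) (phi : R -> R) (u : R -> R -> R) : Prop :=
  [/\ forall x t, - l < x < l -> 0 < t <= T ->
        [/\ caputo_exists T gamma (u x) t,
            fraclap_exists alpha (u^~ t) x &
            caputo T gamma (u x) t =
              - kappa x t * fraclap alpha (u^~ t) x + f x t],
      forall x t, ~~ (- l < x < l) -> 0 <= t <= T -> u x t = 0 &
      forall x, - l < x < l -> u x 0 = phi x].

Definition time_regular (R : realType) (gamma T l c0 : R) (u : R -> R -> R) :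
    Prop :=
  forall x t, - l < x < l -> 0 < t <= T ->
    (forall k, (k < 3)%N -> tderivable T (tderiven T k (u x)) t) /\
    (forall k, (k <= 3)%N ->
       `|tderiven T k (u x) t| <= c0 * t `^ (gamma - k%:R)).

Definition hstep (R : realType) (l : R) (N : nat) : R := 2 * l / N%:R.

Definition xgrid (R : realType) (l : R) (N i : nat) : R :=
  - l + i%:R * hstep l N.

Definition tgrid (R : realType) (T : R) (r M m : nat) : R :=
  (m%:R / M%:R) ^+ r * T.

Definition tau (R : realType) (T : R) (r M m : nat) : R :=
  tgrid T r M m - tgrid T r M m.-1.

Definition l1_coef (R : realType) (gamma T : R) (r M m k : nat) : R :=
  (tau T r M k)^-1 *
  \int[@lebesgue_measure R]_(s in `[tgrid T r M k.-1, tgrid T r M k])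
    ((tgrid T r M m - s) `^ gamma)^-1.

(* [v] is the sequence of time levels v^0, v^1, ... at a fixed node. *)
Definition l1_derive (R : realType) (gamma T : R) (r M : nat) (v : nat -> R)
    (m : nat) : R :=
  (Gamma (1 - gamma))^-1 *
  (l1_coef gamma T r M m m * v m
   - \sum_(1 <= k < m)
       (l1_coef gamma T r M m k.+1 - l1_coef gamma T r M m k) * v k
   - l1_coef gamma T r M m 1 * v 0%N).

Definition kappa_mu (R : realType) (mu : R) : R := if mu < 2 then 1 else 2.

Definition stiff_const (R : realType) (alpha mu l : R) (N : nat) : R :=
  fraclap_const alpha / ((mu - alpha) * hstep l N `^ alpha).

Definition stiff_weight (R : realType) (alpha mu : R) (d : nat) : R :=
  (d.+1%:R `^ (mu - alpha) - d.-1%:R `^ (mu - alpha)) / d%:R `^ mu.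

Definition stiff_coef (R : realType) (alpha mu l : R) (N i j : nat) : R :=
  let nu := mu - alpha in
  let d := (maxn i j - minn i j)%N in
  stiff_const alpha mu l N *
  (if d == 0%N then
     \sum_(2 <= k < N) stiff_weight alpha mu k
     + (N%:R `^ nu - N.-1%:R `^ nu) / N%:R `^ mu
     + (2 `^ nu + kappa_mu mu - 1)
     + 2 * nu / (alpha * N%:R `^ alpha)
   else if d == 1%N then - ((2 `^ nu + kappa_mu mu - 1) / 2)
   else - (stiff_weight alpha mu d / 2)).

(* Grid functions are indexed by nat; only the indices 0..N are meaningful. *)
Definition discrete_fraclap (R : realType) (alpha mu l : R) (N : nat)
    (v : nat -> R) (i : nat) : R :=
  \sum_(1 <= j < N) stiff_coef alpha mu l N i j * v j.

(* A space-time grid function [w] has value [w i m] at (x_i, t_m). *)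
Definition dids_rhs (R : realType) (alpha T l : R) (kappa f : R -> R -> R)
    (mu : R) (r M N : nat) (w : nat -> nat -> R) (i m : nat) : R :=
  - kappa (xgrid l N i) (tgrid T r M m)
    * discrete_fraclap alpha mu l N (w^~ m) i
  + f (xgrid l N i) (tgrid T r M m).

Definition dids_solution (R : realType) (gamma alpha T l : R)
    (kappa f : R -> R -> R) (phi : R -> R) (mu : R) (r M N : nat)
    (w : nat -> nat -> R) : Prop :=
  [/\ forall i m, (1 <= i < N)%N -> (1 <= m <= M)%N ->
        l1_derive gamma T r M (w i) m =
          dids_rhs alpha T l kappa f mu r M N w i m,
      forall m, (m <= M)%N -> w 0%N m = 0 /\ w N m = 0 &
      forall i, (1 <= i < N)%N -> w i 0%N = phi (xgrid l N i)].

Definition grid_values (R : realType) (T l : R) (r M N : nat)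
    (u : R -> R -> R) : nat -> nat -> R :=
  fun i m => u (xgrid l N i) (tgrid T r M m).

Definition truncation_error (R : realType) (gamma alpha T l : R)
    (kappa f : R -> R -> R) (mu : R) (r M N : nat) (u : R -> R -> R)
    (i m : nat) : R :=
  let U := grid_values T l r M N u in
  l1_derive gamma T r M (U i) m - dids_rhs alpha T l kappa f mu r M N U i m.

Definition truncation_bound (R : realType) (gamma alpha T l : R)
    (kappa f : R -> R -> R) (mu : R) (r : nat) (u : R -> R -> R) (p c2 : R) :
    Prop :=
  forall M N i m, (0 < M)%N -> (0 < N)%N ->
    (1 <= i < N)%N -> (1 <= m <= M)%N ->
    `|truncation_error gamma alpha T l kappa f mu r M N u i m|
    <= c2 * (m%:R `^ (- Num.min (r%:R * (1 + gamma)) (2 - gamma))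
             + hstep l N `^ p).

Definition maxnorm (R : realType) (N : nat) (v : nat -> R) : R :=
  \big[Num.max/0]_(i < N.+1) `|v i|.

(* Main.v *)
Require Import Defs.
From HB Require Import structures.
From mathcomp Require Import all_boot all_order all_algebra.
From mathcomp Require Import all_classical all_reals all_analysis.
From mathcomp Require Import ring lra measurable_realfun.
Import Order.TTheory GRing.Theory Num.Theory.
Import numFieldNormedType.Exports.

Set Implicit Arguments.
Unset Strict Implicit.
Unset Printing Implicit Defensive.

Local Open Scope classical_set_scope.
Local Open Scope ring_scope.

(** The error e = U - w vanishes at time zero and at both end points of the
    space grid, and it solves the scheme with source term the truncation error
    R.  Fix a time level m and take a node i where |e_i^m| is largest.  The
    stiffness matrix has nonpositive off-diagonal entries and is weakly
    diagonally dominant, so (A e^m)_i has the sign of e_i^m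
    ([discrete_fraclap_max]); as kappa > 0, the diffusion term only helps, and

      a_m |e_i^m| <= \sum_(1 <= k < m) (a_{k+1} - a_k) |e_i^k|
                     + Gamma(1 - gamma) |R_i^m|,

    where a_k = a^{(m,gamma)}_k.  Here a_1 <= ... <= a_m, because a_k is the
    average over a mesh cell of the increasing kernel s |-> (t_m - s)^(-gamma),
    and for the same reason a_1 >= t_m^(-gamma).  The differences a_{k+1} - a_k
    telescope to a_m - a_1, so an inductive bound B on the earlier levels
    propagates to level m as soon as Gamma(1 - gamma) |R_i^m| <= a_1 B, hence
    as soon as Gamma(1 - gamma) t_m^gamma |R_i^m| <= B.  This gives the
    stability estimate

      |e_i^m| <= Gamma(1 - gamma) max_(j, k) t_k^gamma |R_j^k|

    ([discrete_maximum_principle]).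

    The weight t_k^gamma turns the truncation error into the announced rate.
    On the graded mesh t_k^gamma = T^gamma (k/M)^(r gamma), and with
    beta = min(r(1 + gamma), 2 - gamma), delta = min(r gamma, 2 - gamma) one
    has delta <= beta and delta <= r gamma, so that

      (k/M)^(r gamma) k^(-beta) <= (k/M)^delta k^(-delta) = M^(-delta)

    ([graded_mesh_rate]).  The constant is c2 Gamma(1 - gamma) T^gamma.

    Two analytic facts support this: the singular kernel is integrable up to
    s = t_m, and 0 < Gamma(1 - gamma) < +oo.  Both are needed because a
    divergent integral is valued 0 here, as is the inverse of 0: without them
    a_m or the whole discrete derivative could collapse to 0. *)

(** * Integrability of algebraic singularities *)

(** The fundamental theorem of calculus applies on the compact subintervals
    [[a + d_n, b - d_n]], where the integral of [f] is at most [2 K]; monotone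
    convergence carries the bound to [`]a, b[].  Exhausting the interval from
    inside lets [f] blow up at the end points. *)
Lemma integrable_bounded_primitive (R : realType) (f F : R -> R) (a b K : R) :
  a < b ->
  {in `]a, b[, continuous f} ->
  {in `]a, b[, forall x : R, is_derive x 1 F (f x)} ->
  {in `]a, b[, forall x, 0 <= f x} ->
  {in `]a, b[, forall x, `|F x| <= K} ->
  (@lebesgue_measure R).-integrable `]a, b[ (EFin \o f).
Proof.
move=> ab cf dF f0 FK.
have mf : measurable_fun `]a, b[ f.
  by apply: open_continuous_measurable_fun => // x /set_mem; exact: cf.
apply/integrableP; split; first exact/measurable_EFinP.
under eq_integral => x /set_mem xab do rewrite /= ger0_norm ?f0//.
(* The shift 3 makes the two margins [d n] sum to less than [b - a]. *)
pose d n : R := (b - a) / n.+3%:R.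
have d_gt0 n : 0 < d n by rewrite divr_gt0// subr_gt0.
have d_mid n : a + d n < b - d n.
  suff : d n + d n < b - a by lra.
  rewrite -mulr2n -mulr_natr /d mulrAC ltr_pdivrMr// ltr_pM2l ?subr_gt0//.
  by rewrite ltr_nat.
pose E n : set R := `[a + d n, b - d n]%classic.
have Eab n x : E n x -> x \in `]a, b[.
  rewrite /E /= !in_itv/= => /andP[ax xb].
  by have := d_gt0 n; lra.
have E_cover : \bigcup_n E n = `]a, b[%classic.
  apply/seteqP; split=> x /=; first by move=> [n _ /Eab].
  rewrite in_itv/= => /andP[ax xb].
  pose e := Num.min (x - a) (b - x).
  have e_gt0 : 0 < e by rewrite /e lt_min !subr_gt0 ax.
  pose n := Num.bound ((b - a) / e).
  have : d n <= e.
    rewrite ler_pdivrMr// mulrC -ler_pdivrMr//.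
    apply: ltW; apply: lt_le_trans (archi_boundP _) _.
      by rewrite ltW// divr_gt0// subr_gt0.
    by rewrite ler_nat -addn3 leq_addr.
  rewrite le_min => /andP[dx1 dx2].
  by exists n => //; rewrite /E/= in_itv/=; apply/andP; split; lra.
have E_nd : nondecreasing_seq E.
  move=> m n mn; rewrite subsetEset /E => x /=; rewrite !in_itv/=.
  have : d n <= d m by rewrite ler_pM2l ?subr_gt0// lef_pV2 ?posrE// ler_nat.
  by move=> dnm /andP[? ?]; apply/andP; split; lra.
have mfE n : measurable_fun (E n) (EFin \o f).
  apply/measurable_EFinP; apply: measurable_funS mf => // x; exact: Eab.
have fE0 n x : E n x -> (0 <= (EFin \o f) x)%E.
  by move/Eab => xab; rewrite lee_fin f0.
have Ecvg : (\int[lebesgue_measure]_(x in E i) (f x)%:E)%E @[i --> \oo] -->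
    (\int[@lebesgue_measure R]_(x in `]a, b[) (f x)%:E)%E.
  rewrite -E_cover; apply: ge0_nondecreasing_set_cvg_integral => //.
  by move=> n; exact: measurable_itv.
rewrite -(cvg_lim _ Ecvg)//.
apply: (@le_lt_trans _ _ (K + K)%:E); last exact: ltry.
apply: lime_le; first by apply/cvg_ex; eexists; exact: Ecvg.
apply: nearW => n.
have cF : {in `]a, b[, continuous F}.
  move=> x xab; apply/differentiable_continuous/derivable1_diffP.
  by have [] := dF x xab.
have in_E x : a + d n <= x <= b - d n -> x \in `]a, b[.
  by move=> xE; apply: (Eab n); rewrite /E /= in_itv.
rewrite (@continuous_FTC2 _ f F)//.
- rewrite -EFinB lee_fin; apply: le_trans (ler_norm _) _.
  by apply: le_trans (ler_normB _ _) _; rewrite lerD// FK// in_E// lexx ltW.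
- apply: continuous_in_subspaceT => x /set_mem/=; rewrite in_itv/= => /in_E.
  exact: cf.
- split.
  + by move=> x /subset_itv_oo_cc; rewrite in_itv/= => /in_E /dF[].
  + by apply/cvg_at_right_filter; apply: cF; rewrite in_E// lexx ltW.
  + by apply/cvg_at_left_filter; apply: cF; rewrite in_E// lexx ltW.
- move=> x /subset_itv_oo_cc; rewrite in_itv/= => /in_E /dF xF.
  by rewrite derive1E derive_val.
Qed.

Lemma integrable_powR_sub1 (R : realType) (z : R) : 0 < z ->
  (@lebesgue_measure R).-integrable `]0, 1[ (EFin \o (fun s => s `^ (z - 1))).
Proof.
move=> z_gt0.
apply: (@integrable_bounded_primitive _ _ (fun s => z^-1 * s `^ z) _ _ z^-1)
  => //.
- move=> x; rewrite in_itv/= => /andP[x_gt0 _].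
  apply/differentiable_continuous/derivable1_diffP.
  by apply: derivable_powR; rewrite in_itv/= x_gt0.
- move=> x; rewrite in_itv/= => /andP[x_gt0 _].
  have ? := is_derive1_powR z x_gt0.
  by apply: is_derive_eq; rewrite /GRing.scale/= mulrA mulVf ?gt_eqF// mul1r.
- by move=> x _; exact: powR_ge0.
- move=> x; rewrite in_itv/= => /andP[x_gt0 x_lt1].
  rewrite normrM !ger0_norm ?invr_ge0 ?powR_ge0 ?(ltW z_gt0)//.
  rewrite ler_piMr// ?invr_ge0 ?(ltW z_gt0)//.
  have -> : 1 = 1 `^ z :> R by rewrite powR1.
  by rewrite ge0_ler_powR ?nnegrE ?ltW.
Qed.

Lemma integrable_abel_kernel (R : realType) (gamma a c : R) :
  0 < gamma < 1 -> a < c ->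
  (@lebesgue_measure R).-integrable `]a, c[
    (EFin \o (fun s => ((c - s) `^ gamma)^-1)).
Proof.
move=> /andP[g_gt0 g_lt1] ac.
have q_gt0 : 0 < 1 - gamma by rewrite subr_gt0.
have dpow q x : x \in `]a, c[ ->
    is_derive x 1 (fun s => (c - s) `^ q) (- (q * (c - x) `^ (q - 1))).
  rewrite in_itv/= => /andP[_ xc].
  have xc' : 0 < c - x by rewrite subr_gt0.
  have := @is_derive1_comp _ (@powR R ^~ q) (fun s => c - s) x _ _
    (is_derive1_powR q xc').
  move=> /(_ (-1)) H; apply: is_derive_eq.
    by apply: H; apply: is_derive_eq; rewrite add0r mul1r.
  by rewrite /= mulrN1.
apply: (@integrable_bounded_primitive _ _
  (fun s => - (1 - gamma)^-1 * (c - s) `^ (1 - gamma)) _ _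
  ((1 - gamma)^-1 * (c - a) `^ (1 - gamma))) => //.
- have -> : (fun s => ((c - s) `^ gamma)^-1) = (fun s => (c - s) `^ (- gamma)).
    by apply/funext => s; rewrite powRN.
  move=> x xac; apply/differentiable_continuous/derivable1_diffP.
  by have [] := dpow (- gamma) x xac.
- move=> x xac; have ? := dpow (1 - gamma) x xac.
  apply: is_derive_eq; rewrite /GRing.scale/= -powRN mulrNN mulrA.
  by rewrite mulVf ?gt_eqF// mul1r; congr (_ `^ _); ring.
- by move=> x _; rewrite invr_ge0 powR_ge0.
- move=> x; rewrite in_itv/= => /andP[ax xc].
  rewrite normrM normrN !ger0_norm ?invr_ge0 ?powR_ge0 ?(ltW q_gt0)//.
  rewrite ler_pM2l ?invr_gt0// ge0_ler_powR ?nnegrE ?subr_ge0 ?(ltW q_gt0)//;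
    lra.
Qed.

(** * Cell averages of the kernel *)

Lemma integrable_cst_oo (R : realType) (a b k : R) :
  (@lebesgue_measure R).-integrable `]a, b[ (EFin \o (fun=> k)).
Proof.
have : (@lebesgue_measure R).-integrable `[a, b] (EFin \o (fun=> k)).
  apply: continuous_compact_integrable; first exact: segment_compact.
  by apply: continuous_subspaceT => x; exact: cst_continuous.
by apply: integrableS => //; exact: subset_itv_oo_cc.
Qed.

Lemma Rintegral_cst_oo (R : realType) (a b k : R) : a < b ->
  \int[@lebesgue_measure R]_(s in `]a, b[) k = k * (b - a).
Proof.
by rewrite Rintegral_cst//= lebesgue_measure_itv/= lte_fin => ->.
Qed.

(** The kernel increases with [s], so its average over a cell lies between its
    values at the two ends.  In the lower bound [b = c] is allowed: the average
    then includes the singularity, and integrability is what keeps it from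
    being read as 0. *)
Lemma abel_kernel_average_ge (R : realType) (gamma a b c : R) :
  0 < gamma < 1 -> a < b -> b <= c ->
  ((c - a) `^ gamma)^-1 <=
  (b - a)^-1 * \int[@lebesgue_measure R]_(s in `[a, b]) ((c - s) `^ gamma)^-1.
Proof.
move=> g01 ab bc; have [g_gt0 _] := andP g01.
have ik : (@lebesgue_measure R).-integrable `]a, b[
    (EFin \o (fun s => ((c - s) `^ gamma)^-1)).
  apply: integrableS (integrable_abel_kernel g01 (lt_le_trans ab bc)) => //.
  exact: subset_itvl.
rewrite /Rintegral integral_itv_bndoo; last exact: measurable_int ik.
rewrite ler_pdivlMl ?subr_gt0// mulrC.
have -> : ((c - a) `^ gamma)^-1 * (b - a) =
    \int[@lebesgue_measure R]_(s in `]a, b[) ((c - a) `^ gamma)^-1.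
  by rewrite Rintegral_cst_oo.
apply: le_Rintegral => //; first exact: integrable_cst_oo.
move=> x /=; rewrite in_itv/= => /andP[ax xb].
have xc : 0 < c - x by lra.
rewrite lef_pV2 ?posrE ?powR_gt0//; last lra.
by rewrite ge0_ler_powR ?nnegrE; lra.
Qed.

Lemma abel_kernel_average_le (R : realType) (gamma a b c : R) :
  0 < gamma < 1 -> a < b -> b < c ->
  (b - a)^-1 * \int[@lebesgue_measure R]_(s in `[a, b]) ((c - s) `^ gamma)^-1
  <= ((c - b) `^ gamma)^-1.
Proof.
move=> g01 ab bc; have [g_gt0 _] := andP g01.
have ik : (@lebesgue_measure R).-integrable `]a, b[
    (EFin \o (fun s => ((c - s) `^ gamma)^-1)).
  apply: integrableS (integrable_abel_kernel g01 (lt_trans ab bc)) => //.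
  by apply: subset_itvl; rewrite bnd_simp ltW.
rewrite /Rintegral integral_itv_bndoo; last exact: measurable_int ik.
rewrite ler_pdivrMl ?subr_gt0// mulrC -(Rintegral_cst_oo _ ab).
apply: le_Rintegral => //; first exact: integrable_cst_oo.
move=> x /=; rewrite in_itv/= => /andP[ax xb].
have [xc cb] : 0 < c - x /\ 0 < c - b by lra.
rewrite lef_pV2 ?posrE ?powR_gt0//.
by rewrite ge0_ler_powR ?nnegrE; lra.
Qed.

(** * The Gamma function near 0 *)

(** The integrand is dominated by [s `^ (z - 1)] on [`]0, 1[] and, since
    [z <= 1], by [expR (- s)] beyond 1, so the integral is finite; on
    [`]0, 1[] it is at least [expR (- 1)]. *)
Lemma Gamma_gt0 (R : realType) (z : R) : 0 < z <= 1 -> 0 < Gamma z.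
Proof.
move=> /andP[z_gt0 z_le1].
pose g (s : R) := s `^ (z - 1) * expR (- s).
have g_ge0 s : 0 <= g s by rewrite mulr_ge0 ?powR_ge0 ?expR_ge0.
have mg : measurable_fun setT g.
  apply: measurable_funM; first exact: measurable_powR.
  by apply: measurableT_comp => //; exact: measurable_expR.
have mgD D : measurable D -> measurable_fun D (EFin \o g).
  by move=> mD; apply/measurable_EFinP; exact: measurable_funTS.
have ig1 : (@lebesgue_measure R).-integrable `]0, 1[ (EFin \o g).
  apply: le_integrable (integrable_powR_sub1 z_gt0) => //; first exact: mgD.
  move=> x /=; rewrite in_itv/= => /andP[x_gt0 _].
  rewrite lee_fin !ger0_norm ?powR_ge0// ler_piMr ?powR_ge0//.
  by rewrite expR_le1 oppr_le0 ltW.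
have igy : (@lebesgue_measure R).-integrable `[1, +oo[ (EFin \o g).
  have : (@lebesgue_measure R).-integrable `[1, +oo[
      (EFin \o exponential_pdf 1).
    by apply: integrableS (integrable_exponential_pdf ltr01).
  apply: le_integrable => //; first exact: mgD.
  move=> x /=; rewrite in_itv/= andbT => x_ge1.
  have x_ge0 : 0 <= x by lra.
  rewrite lee_fin exponential_pdfE// mul1r mulN1r !ger0_norm ?expR_ge0//.
  rewrite ler_piMl ?expR_ge0// -[leRHS](powRr0 x) ler_powR//; lra.
have ig : (@lebesgue_measure R).-integrable `]0, +oo[ (EFin \o g).
  apply/integrableP; split; first exact: mgD.
  have abs_g D : (\int[@lebesgue_measure R]_(x in D) `|(EFin \o g) x| =
      \int[@lebesgue_measure R]_(x in D) (EFin \o g) x)%E.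
    by apply: eq_integral => x _; rewrite /= ger0_norm.
  rewrite abs_g (_ : `]0, +oo[%classic = `]0, 1[ `|` `[1, +oo[); last first.
    by rewrite -itv_bndbnd_setU ?bnd_simp.
  rewrite ge0_integral_setU//=.
  - rewrite lte_add_pinfty//.
      by rewrite -abs_g; case/integrableP: ig1.
    by rewrite -abs_g; case/integrableP: igy.
  - by apply: mgD; exact: measurableU.
  - by move=> x _; rewrite lee_fin.
  - apply/disj_setPS => x [] /=; rewrite !in_itv/= => /andP[_ xlt1].
    by rewrite leNgt xlt1.
have : expR (-1) <= Gamma z; last by apply: lt_le_trans; exact: expR_gt0.
have <- : \int[@lebesgue_measure R]_(s in `]0, 1[) expR (-1) = expR (-1).
  by rewrite Rintegral_cst_oo// subr0 mulr1.
apply: (@le_trans _ _ (\int[@lebesgue_measure R]_(s in `]0, 1[) g s)).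
  apply: le_Rintegral => //; first exact: integrable_cst_oo.
  move=> x /=; rewrite in_itv/= => /andP[x_gt0 x_lt1].
  apply: (@le_trans _ _ (expR (- x))); first by rewrite ler_expR; lra.
  rewrite ler_peMl ?expR_ge0// -[leLHS](powRr0 x) ger_powR; lra.
apply: fine_le; [exact: integrable_fin_num..|].
apply: ge0_subset_integral => //; first exact: mgD.
- by move=> x _; rewrite lee_fin.
- exact: subset_itvl.
Qed.

(** * Diagonal dominance of the stiffness matrix *)

(** Each distance occurs at most twice, once on each side of [i]. *)
Lemma sum_dist_le (R : numDomainType) (c : nat -> R) (N i : nat) :
  (forall d, 0 <= c d) -> (1 <= i < N)%N ->
  \sum_(1 <= j < N | j != i) c (maxn i j - minn i j)%N
  <= 2 * \sum_(1 <= d < N) c d.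
Proof.
move=> c_ge0 /andP[i_gt0 i_ltN].
have tail_le n : (1 <= n <= N)%N ->
    \sum_(1 <= d < n) c d <= \sum_(1 <= d < N) c d.
  move=> /andP[n_gt0 n_leN]; rewrite [leRHS](big_cat_nat n_gt0 n_leN)/=.
  by rewrite lerDl sumr_ge0.
rewrite (big_cat_nat i_gt0 (ltnW i_ltN))/= [X in _ + X]big_ltn_cond// eqxx/=.
rewrite mulrDl mul1r; apply: lerD.
- apply: le_trans (tail_le i _); last by rewrite i_gt0 ltnW.
  rewrite [leRHS]big_nat_rev/= big_mkcond/= !big_nat.
  apply: ler_sum => j /andP[j_gt0 ji].
  case: ifP => // _; rewrite (maxn_idPl (ltnW ji)) (minn_idPr (ltnW ji)).
  by rewrite add1n subSS.
- apply: le_trans (tail_le (N - i)%N _); last first.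
    by rewrite subn_gt0 i_ltN leq_subr.
  rewrite -[X in index_iota X _](add1n i) big_addn big_mkcond/= !big_nat.
  apply: ler_sum => j _; case: ifP => // _.
  by rewrite (maxn_idPr (leq_addl _ _)) (minn_idPl (leq_addl _ _)) addnK.
Qed.

(** The modulus of the entry a_ij with |i - j| = d > 0, divided by the common
    prefactor [stiff_const]. *)
Definition offdiag_weight (R : realType) (alpha mu : R) (d : nat) : R :=
  if d == 1%N then (2 `^ (mu - alpha) + kappa_mu mu - 1) / 2
  else stiff_weight alpha mu d / 2.

Lemma offdiag_weight_ge0 (R : realType) (alpha mu : R) (d : nat) :
  alpha <= mu -> 0 <= offdiag_weight alpha mu d.
Proof.
move=> am; rewrite /offdiag_weight; case: ifP => _; rewrite divr_ge0//.
  have := powR_ge0 (2 : R) (mu - alpha).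
  by rewrite /kappa_mu; case: ifP => _; lra.
rewrite divr_ge0 ?powR_ge0// subr_ge0 ge0_ler_powR ?nnegrE ?ler0n ?subr_ge0//.
by rewrite ler_nat; case: d => // d /=; rewrite ltnW// ltnW.
Qed.

Lemma fraclap_const_ge0 (R : realType) (alpha : R) : 0 <= alpha ->
  0 <= fraclap_const alpha.
Proof.
move=> a_ge0; have G_ge0 (z : R) : 0 <= Gamma z.
  by apply: Rintegral_ge0 => s _; rewrite mulr_ge0 ?powR_ge0 ?expR_ge0.
by rewrite divr_ge0 ?mulr_ge0 ?powR_ge0 ?sqrtr_ge0 ?G_ge0.
Qed.

Lemma stiff_const_ge0 (R : realType) (alpha mu l : R) (N : nat) :
  0 <= alpha -> alpha <= mu -> 0 <= stiff_const alpha mu l N.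
Proof.
move=> a_ge0 am.
by rewrite divr_ge0 ?fraclap_const_ge0 ?mulr_ge0 ?powR_ge0 ?subr_ge0.
Qed.

Lemma stiff_coef_offdiag (R : realType) (alpha mu l : R) (N i j : nat) :
  j != i -> stiff_coef alpha mu l N i j =
    - (stiff_const alpha mu l N
       * offdiag_weight alpha mu (maxn i j - minn i j)).
Proof.
move=> ji; rewrite /stiff_coef/= ifF.
  by rewrite -[RHS]mulrN /offdiag_weight; case: ifP.
apply/negP; rewrite subn_eq0 => h; move: ji; apply/negP; rewrite negbK.
move: h; rewrite geq_max !leq_min => /andP[/andP[_ ij] /andP[ji _]].
by rewrite eqn_leq ij ji.
Qed.

(** The diagonal entry contains the weights of all distances 1, ..., N - 1
    twice, as if every node had both neighbours at each of these distances;
    what remains of it is nonnegative. *)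
Lemma stiff_coef_diag_ge (R : realType) (alpha mu l : R) (N i : nat) :
  0 < alpha -> alpha <= mu -> (1 < N)%N ->
  stiff_const alpha mu l N * (2 * \sum_(1 <= d < N) offdiag_weight alpha mu d)
  <= stiff_coef alpha mu l N i i.
Proof.
move=> a_gt0 am N_gt1; rewrite /stiff_coef/= maxnn minnn subnn eqxx.
apply: ler_wpM2l; first by rewrite stiff_const_ge0 ?(ltW a_gt0).
rewrite big_ltn//= {1}/offdiag_weight eqxx mulrDr mulrCA divff ?pnatr_eq0//.
rewrite mulr1.
have -> : 2 * \sum_(2 <= d < N) offdiag_weight alpha mu d =
    \sum_(2 <= d < N) stiff_weight alpha mu d.
  rewrite mulr_sumr; apply: eq_big_nat => d /andP[d_gt1 _].
  by rewrite /offdiag_weight gtn_eqF// mulrCA divff ?mulr1 ?pnatr_eq0.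
have last_ge0 :
    0 <= (N%:R `^ (mu - alpha) - N.-1%:R `^ (mu - alpha)) / N%:R `^ mu.
  rewrite divr_ge0 ?powR_ge0// subr_ge0 ge0_ler_powR ?nnegrE ?ler0n ?subr_ge0//.
  by rewrite ler_nat leq_pred.
have far_ge0 : 0 <= 2 * (mu - alpha) / (alpha * N%:R `^ alpha).
  by rewrite divr_ge0 ?mulr_ge0 ?powR_ge0 ?subr_ge0// ltW.
lra.
Qed.

(** At a node where |v| is largest, the diagonal term beats the sum of all
    others by diagonal dominance. *)
Lemma discrete_fraclap_max (R : realType) (alpha mu l : R) (N i : nat)
    (v : nat -> R) :
  0 < alpha -> alpha <= mu -> (1 <= i < N)%N ->
  (forall j, (1 <= j < N)%N -> `|v j| <= `|v i|) ->
  0 <= Num.sg (v i) * discrete_fraclap alpha mu l N v i.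
Proof.
move=> a_gt0 am iN vmax; have /andP[i_gt0 i_ltN] := iN.
set K := stiff_const alpha mu l N.
have K_ge0 : 0 <= K by rewrite stiff_const_ge0 ?(ltW a_gt0).
rewrite /discrete_fraclap (bigD1_seq i) ?mem_index_iota ?iota_uniq//=.
rewrite mulrDr mulrCA -normrEsg mulr_sumr.
have : - (K * (\sum_(1 <= j < N | j != i)
                  offdiag_weight alpha mu (maxn i j - minn i j)) * `|v i|) <=
    \sum_(1 <= j < N | j != i)
       Num.sg (v i) * (stiff_coef alpha mu l N i j * v j).
  rewrite -mulrA mulr_suml mulr_sumr -sumrN big_nat_cond [leRHS]big_nat_cond.
  apply: ler_sum => j /andP[jN ji].
  rewrite stiff_coef_offdiag// [leRHS]mulrCA mulNr lerN2 -[leLHS]mulrA.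
  rewrite ler_wpM2l// ler_wpM2l ?offdiag_weight_ge0//.
  apply: le_trans (ler_norm _) _; rewrite normrM normr_sg.
  by apply: le_trans (vmax j jN); rewrite ler_piMl// lern1 leq_b1.
move=> offdiag_ge; apply: le_trans (lerD (lexx _) offdiag_ge).
rewrite -mulrBl mulr_ge0// subr_ge0.
apply: le_trans (stiff_coef_diag_ge _ _ a_gt0 am (leq_ltn_trans i_gt0 i_ltN)).
apply: ler_wpM2l => //; apply: sum_dist_le => // d; exact: offdiag_weight_ge0.
Qed.

(** * Space and time grids *)

Lemma tgrid_lt (R : realType) (T : R) (r M i j : nat) :
  0 < T -> (0 < r)%N -> (0 < M)%N -> (i < j)%N ->
  tgrid T r M i < tgrid T r M j.
Proof.
move=> T_gt0 r_gt0 M_gt0 ij; rewrite ltr_pM2r// ltr_pXn2r ?nnegrE ?divr_ge0//.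
by rewrite ltr_pM2r ?invr_gt0 ?ltr0n// ltr_nat.
Qed.

Lemma tgrid0 (R : realType) (T : R) (r M : nat) : (0 < r)%N ->
  tgrid T r M 0 = 0.
Proof. by move=> r_gt0; rewrite /tgrid mul0r expr0n gtn_eqF// mul0r. Qed.

Lemma tgrid_last (R : realType) (T : R) (r M : nat) : (0 < M)%N ->
  tgrid T r M M = T.
Proof.
by move=> M_gt0; rewrite /tgrid divff ?pnatr_eq0 -?lt0n// expr1n mul1r.
Qed.

Lemma tgrid_in (R : realType) (T : R) (r M m : nat) :
  0 < T -> (0 < r)%N -> (1 <= m <= M)%N -> 0 < tgrid T r M m <= T.
Proof.
move=> T_gt0 r_gt0 /andP[m_gt0 mM]; have M_gt0 := leq_trans m_gt0 mM.
rewrite -(tgrid0 T M r_gt0) tgrid_lt//=.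
move: mM; rewrite leq_eqVlt => /predU1P[->|mM].
  by rewrite tgrid_last.
by rewrite -[leRHS](@tgrid_last _ T r M)// ltW// tgrid_lt.
Qed.

Lemma xgrid_in (R : realType) (l : R) (N i : nat) : 0 < l -> (1 <= i < N)%N ->
  - l < xgrid l N i < l.
Proof.
move=> l_gt0 /andP[i_gt0 iN].
have N_gt0 : (0 : R) < N%:R by rewrite ltr0n (leq_trans _ iN).
have h_gt0 : 0 < hstep l N by rewrite divr_gt0// mulr_gt0.
rewrite /xgrid ltrDl mulr_gt0 ?ltr0n//=.
have : i%:R * hstep l N < 2 * l; last lra.
by rewrite /hstep mulrCA gtr_pMr ?mulr_gt0// ltr_pdivrMr// mul1r ltr_nat.
Qed.

Lemma xgrid0 (R : realType) (l : R) (N : nat) : xgrid l N 0 = - l.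
Proof. by rewrite /xgrid mul0r addr0. Qed.

Lemma xgrid_last (R : realType) (l : R) (N : nat) : (0 < N)%N ->
  xgrid l N N = l.
Proof.
move=> N_gt0; rewrite /xgrid /hstep mulrCA divff ?pnatr_eq0 -?lt0n// mulr1.
ring.
Qed.

(** * The discrete Caputo derivative *)

(** The value of the kernel at the common end [t_k] separates the averages over
    two consecutive cells. *)
Lemma l1_coef_nondecreasing (R : realType) (gamma T : R) (r M m k : nat) :
  0 < gamma < 1 -> 0 < T -> (0 < r)%N -> (0 < M)%N -> (1 <= k < m)%N ->
  l1_coef gamma T r M m k <= l1_coef gamma T r M m k.+1.
Proof.
move=> g01 T_gt0 r_gt0 M_gt0 /andP[k_gt0 km].
have mono i j : (i < j)%N -> tgrid T r M i < tgrid T r M j by exact: tgrid_lt.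
rewrite /l1_coef /tau /=.
apply: (@le_trans _ _ ((tgrid T r M m - tgrid T r M k) `^ gamma)^-1).
  apply: abel_kernel_average_le => //; apply: mono => //.
  by rewrite prednK.
apply: abel_kernel_average_ge => //; first exact: mono.
by move: km; rewrite leq_eqVlt => /predU1P[->//|km]; rewrite ltW// mono.
Qed.

Lemma l1_coef1_ge (R : realType) (gamma T : R) (r M m : nat) :
  0 < gamma < 1 -> 0 < T -> (0 < r)%N -> (0 < M)%N -> (0 < m)%N ->
  (tgrid T r M m `^ gamma)^-1 <= l1_coef gamma T r M m 1.
Proof.
move=> g01 T_gt0 r_gt0 M_gt0 m_gt0.
rewrite -[in leLHS](subr0 (tgrid T r M m)) -[in leLHS](@tgrid0 _ T r M)//.
apply: abel_kernel_average_ge => //; first exact: tgrid_lt.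
move: m_gt0; rewrite leq_eqVlt => /predU1P[<-//|m_gt1].
by rewrite ltW// tgrid_lt.
Qed.

(** Isolate [v m] in the discrete derivative.  The weights of the history
    [v 1], ..., [v m.-1] telescope to [a m - a 1], so the history contributes
    at most [(a m - a 1) * B] to [a m * `|v m|]; the missing [a 1 * B] pays for
    the source, as [a 1] is at least the inverse of
    [tgrid T r M m `^ gamma]. *)
Lemma l1_derive_step (R : realType) (gamma T : R) (r M m : nat)
    (v : nat -> R) (B rho : R) :
  0 < gamma < 1 -> 0 < T -> (0 < r)%N -> (0 < M)%N -> (0 < m)%N ->
  v 0%N = 0 -> 0 <= B ->
  (forall k, (1 <= k < m)%N -> `|v k| <= B) ->
  Num.sg (v m) * l1_derive gamma T r M v m <= rho ->
  Gamma (1 - gamma) * tgrid T r M m `^ gamma * rho <= B ->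
  `|v m| <= B.
Proof.
move=> g01 T_gt0 r_gt0 M_gt0 m_gt0 v0 B_ge0 vB vm_rho rhoB.
set a := l1_coef gamma T r M m.
have G_gt0 : 0 < Gamma (1 - gamma) by apply: Gamma_gt0; lra.
have t_gt0 : 0 < tgrid T r M m by rewrite -(@tgrid0 _ T r M)// tgrid_lt.
have a_mono k : (1 <= k < m)%N -> 0 <= a k.+1 - a k.
  by move=> km; rewrite subr_ge0; exact: l1_coef_nondecreasing.
have a1_ge : (tgrid T r M m `^ gamma)^-1 <= a 1%N by exact: l1_coef1_ge.
have a1_gt0 : 0 < a 1%N.
  by apply: lt_le_trans a1_ge; rewrite invr_gt0 powR_gt0.
have tele : \sum_(1 <= k < m) (a k.+1 - a k) = a m - a 1%N.
  by rewrite telescope_sumr.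
have am_gt0 : 0 < a m.
  by rewrite -[a m](subrK (a 1%N)) -tele ltr_wpDl// big_nat sumr_ge0.
rewrite -(ler_pM2l am_gt0).
have history : Num.sg (v m) * \sum_(1 <= k < m) (a k.+1 - a k) * v k
    <= (a m - a 1%N) * B.
  rewrite -tele mulr_suml mulr_sumr big_nat [leRHS]big_nat.
  apply: ler_sum => k km; rewrite mulrCA ler_wpM2l ?a_mono//.
  apply: le_trans (ler_norm _) _; rewrite normrM normr_sg.
  by apply: le_trans (vB k km); rewrite ler_piMl// lern1 leq_b1.
move: vm_rho; rewrite /l1_derive -/a v0 mulr0 subr0 mulrCA ler_pdivrMl//.
rewrite mulrBr mulrCA -normrEsg => vm_rho.
suff : Gamma (1 - gamma) * rho <= a 1%N * B by lra.
apply: le_trans (ler_wpM2r B_ge0 a1_ge).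
by rewrite ler_pdivlMl ?powR_gt0// mulrCA mulrA.
Qed.

(** * Stability of the scheme *)

(** By induction on the time level, applying [l1_derive_step] at the node where
    the modulus of [e^~ m] is largest: at that node the diffusion term has the
    sign of the solution, and only the source remains. *)
Lemma discrete_maximum_principle (R : realType) (gamma alpha T l mu : R)
    (r M N : nat) (kap rhs e : nat -> nat -> R) (B : R) :
  0 < gamma < 1 -> 0 < alpha -> alpha <= mu -> 0 < T -> (0 < r)%N -> 0 <= B ->
  (forall i m, (1 <= i < N)%N -> (1 <= m <= M)%N -> 0 <= kap i m) ->
  (forall i m, (1 <= i < N)%N -> (1 <= m <= M)%N ->
     l1_derive gamma T r M (e i) m =
     - kap i m * discrete_fraclap alpha mu l N (e^~ m) i + rhs i m) ->
  (forall m, (m <= M)%N -> e 0%N m = 0 /\ e N m = 0) ->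
  (forall i, (1 <= i < N)%N -> e i 0%N = 0) ->
  (forall i m, (1 <= i < N)%N -> (1 <= m <= M)%N ->
     Gamma (1 - gamma) * tgrid T r M m `^ gamma * `|rhs i m| <= B) ->
  forall i m, (i <= N)%N -> (1 <= m <= M)%N -> `|e i m| <= B.
Proof.
move=> g01 a_gt0 amu T_gt0 r_gt0 B_ge0 kap_ge0 scheme e_bd e_init rhsB i m iN.
elim/ltn_ind: m i iN => m IHm i iN mM.
have [m_gt0 m_leM] := andP mM.
have [i0 _ i0max] := @arg_maxP _ _ 'I_N.+1 ord0 xpredT (fun j => `|e j m|) isT.
apply: (le_trans (i0max (Ordinal (iN : i < N.+1)%N) isT)).
have [i0_gt0|] := ltnP 0 i0; last first.
  by rewrite leqn0 => /eqP ->; rewrite (e_bd m m_leM).1 normr0.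
have [i0_ltN|] := ltnP i0 N; last first.
  move=> Ni0; have -> : i0 = N :> nat.
    by apply/eqP; rewrite eqn_leq Ni0 -ltnS ltn_ord.
  by rewrite (e_bd m m_leM).2 normr0.
have i0N : (1 <= i0 < N)%N by rewrite i0_gt0.
apply: (l1_derive_step (rho := `|rhs i0 m|) g01 T_gt0 r_gt0)
  (rhsB _ _ i0N mM) => //.
- exact: leq_trans m_leM.
- exact: e_init.
- move=> k /andP[k_gt0 km]; apply: IHm => //; first exact: ltnW.
  by rewrite k_gt0 (leq_trans (ltnW km)).
rewrite scheme// mulrDr mulNr mulrN mulrCA.
have diss : 0 <= Num.sg (e i0 m) * discrete_fraclap alpha mu l N (e^~ m) i0.
  apply: discrete_fraclap_max => // j /andP[_ jN].
  by have := i0max (inord j) isT; rewrite inordK// ltnW.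
have : Num.sg (e i0 m) * rhs i0 m <= `|rhs i0 m|.
  apply: le_trans (ler_norm _) _; rewrite normrM normr_sg.
  by rewrite ler_piMl// lern1 leq_b1.
have := mulr_ge0 (kap_ge0 _ _ i0N mM) diss.
lra.
Qed.

(** * Rate of convergence on the graded mesh *)

(** Weakening both exponents r gamma and min(r(1 + gamma), 2 - gamma) to
    their common lower bound delta = min(r gamma, 2 - gamma) makes the powers
    of [m] cancel. *)
Lemma graded_mesh_rate (R : realType) (gamma T : R) (r M m : nat) :
  0 < gamma < 1 -> 0 < T -> (1 <= m <= M)%N ->
  tgrid T r M m `^ gamma * m%:R `^ (- Num.min (r%:R * (1 + gamma)) (2 - gamma))
  <= T `^ gamma * M%:R `^ (- Num.min (r%:R * gamma) (2 - gamma)).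
Proof.
move=> /andP[g_gt0 g_lt1] T_gt0 /andP[m_gt0 mM].
have M_gt0 := leq_trans m_gt0 mM.
have mR_gt0 : (0 : R) < m%:R by rewrite ltr0n.
have MR_gt0 : (0 : R) < M%:R by rewrite ltr0n.
have q_gt0 : (0 : R) < m%:R / M%:R by rewrite divr_gt0.
set beta := Num.min (r%:R * (1 + gamma)) (2 - gamma).
set delta := Num.min (r%:R * gamma) (2 - gamma).
have delta_beta : delta <= beta.
  rewrite /delta /beta le_min !ge_min lexx orbT andbT.
  by rewrite ler_wpM2l//; lra.
have -> : tgrid T r M m `^ gamma = T `^ gamma * (m%:R / M%:R) `^ (r%:R * gamma).
  rewrite /tgrid powRM ?exprn_ge0 ?(ltW q_gt0) ?(ltW T_gt0)// mulrC powRrM.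
  by rewrite powR_mulrn ?(ltW q_gt0).
rewrite -mulrA ler_pM2l ?powR_gt0//.
apply: (@le_trans _ _ ((m%:R / M%:R) `^ delta * m%:R `^ (- delta))).
  apply: ler_pM; rewrite ?powR_ge0//.
    rewrite ger_powR ?q_gt0 ?ler_pdivrMr ?mul1r ?ler_nat//.
    by rewrite /delta ge_min lexx.
  by rewrite ler_powR ?ler1n ?lerN2.
rewrite powRM ?invr_ge0 ?(ltW mR_gt0) ?(ltW MR_gt0)// mulrAC powRN divff ?mul1r.
  by rewrite -powR_inv1 ?(ltW MR_gt0)// -powRrM mulN1r.
by rewrite gt_eqF ?powR_gt0.
Qed.

(** * Error equation and conclusion *)

Lemma l1_deriveB (R : realType) (gamma T : R) (r M m : nat) (v w : nat -> R) :
  l1_derive gamma T r M (fun k => v k - w k) m =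
  l1_derive gamma T r M v m - l1_derive gamma T r M w m.
Proof.
rewrite /l1_derive -mulrBr; congr (_ * _).
under eq_bigr do rewrite mulrBr.
rewrite sumrB; ring.
Qed.

Lemma discrete_fraclapB (R : realType) (alpha mu l : R) (N i : nat)
    (v w : nat -> R) :
  discrete_fraclap alpha mu l N (fun j => v j - w j) i =
  discrete_fraclap alpha mu l N v i - discrete_fraclap alpha mu l N w i.
Proof.
by rewrite /discrete_fraclap -sumrB; apply: eq_bigr => j _; rewrite mulrBr.
Qed.

Theorem theorem2p5 (R : realType) (gamma alpha T l : R)
    (hgamma : 0 < gamma < 1) (halpha : 0 < alpha < 2) (hT : 0 < T) (hl : 0 < l)
    (kappa f : R -> R -> R) (phi : R -> R)
    (hkappa : forall x t : R, - l < x < l -> 0 < t <= T -> 0 < kappa x t)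
    (u : R -> R -> R)
    (hu : diffusion_solution gamma alpha T l kappa f phi u)
    (c0 : R) (hc0 : 0 < c0) (hreg : time_regular gamma T l c0 u)
    (r : nat) (hr : (0 < r)%N)
    (mu : R) (hmu : alpha < mu <= 2)
    (p : R) (hp : 0 < p <= 2)
    (hR : exists2 c2 : R, 0 < c2 &
            truncation_bound gamma alpha T l kappa f mu r u p c2) :
  exists2 C : R, 0 < C &
    forall M N : nat, (0 < M)%N -> (0 < N)%N ->
    forall w : nat -> nat -> R,
      dids_solution gamma alpha T l kappa f phi mu r M N w ->
    forall m : nat, (1 <= m <= M)%N ->
      maxnorm N (fun i => grid_values T l r M N u i m - w i m)
      <= C * (M%:R `^ (- Num.min (r%:R * gamma) (2 - gamma))
              + hstep l N `^ p).
Proof.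
have [c2 c2_gt0 trunc] := hR.
have [alpha_gt0 _] := andP halpha; have [alpha_mu _] := andP hmu.
have G_gt0 : 0 < Gamma (1 - gamma) by apply: Gamma_gt0; lra.
have [_ u_out u_init] := hu.
exists (Gamma (1 - gamma) * T `^ gamma * c2).
  by rewrite !mulr_gt0 ?powR_gt0.
move=> M N M_gt0 N_gt0 w [w_scheme w_bd w_init] m mM.
set rate := M%:R `^ _ + _.
have rate_ge0 : 0 <= rate by rewrite addr_ge0 ?powR_ge0.
set B := _ * rate.
have B_ge0 : 0 <= B.
  by rewrite !mulr_ge0 ?powR_ge0 ?(ltW G_gt0) ?(ltW c2_gt0).
pose U := grid_values T l r M N u.
pose e i k := U i k - w i k.
have t_le k : (k <= M)%N -> 0 <= tgrid T r M k <= T.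
  case: k => [_|k kM]; first by rewrite tgrid0// lexx ltW.
  by have /andP[/ltW -> ->] := @tgrid_in _ T r M k.+1 hT hr kM.
have e_small i k : (i <= N)%N -> (1 <= k <= M)%N -> `|e i k| <= B.
  apply: (@discrete_maximum_principle _ gamma alpha T l mu r M N
    (fun i k => kappa (xgrid l N i) (tgrid T r M k))
    (truncation_error gamma alpha T l kappa f mu r M N u)) => //.
  - exact: ltW.
  - by move=> j n jN nM; rewrite ltW// hkappa ?xgrid_in ?tgrid_in.
  - move=> j n jN nM; rewrite l1_deriveB discrete_fraclapB w_scheme//.
    by rewrite /truncation_error /dids_rhs -/U; ring.
  - move=> n nM; have [w0 wN] := w_bd n nM.
    rewrite /e w0 wN !subr0 /U /grid_values xgrid0 xgrid_last//.
    by split; apply: u_out; rewrite ?t_le// ltxx ?andbF.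
  - move=> j jN; rewrite /e w_init// /U /grid_values tgrid0// u_init ?subrr//.
    exact: xgrid_in.
  - move=> j n jN nM; rewrite /B -!mulrA ler_pM2l//.
    apply: le_trans (ler_wpM2l _ (trunc _ _ _ _ M_gt0 N_gt0 jN nM)) _.
      exact: powR_ge0.
    rewrite mulrCA [leRHS]mulrCA ler_pM2l// (mulrDr (_ `^ gamma)).
    rewrite [leRHS]mulrDr lerD ?graded_mesh_rate//.
    have /andP[t_ge0 t_leT] := t_le n (andP nM).2.
    by rewrite ler_wpM2r ?powR_ge0// ge0_ler_powR ?nnegrE; lra.
apply: bigmax_le => // i _.
by apply: e_small => //; rewrite -ltnS ltn_ord.
Qed.
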